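(* Let $R\cong \mathbb Z_{p_1^{t_1}}\times\cdots\times\mathbb Z_{p_r^{t_r}}$ for (not necessarily distinct) prime numbers $p_1,\dots,p_r$ and positive integers $r,t_1,\dots,t_r$. Then the zero-divisor graph $\Gamma(R)$ has $$\prod_{i=1}^r (t_i+1) - 2$$ non-zero eigenvalues (counted with multiplicity), and the nullity of $\Gamma(R)$ equals $$\eta(\Gamma(R)) = \prod_{i=1}^r p_i^{t_i-1}\Big(\prod_{i=1}^r p_i - \prod_{i=1}^r (p_i-1)\Big) - \prod_{i=1}^r (t_i+1) + 1 .$$
   Context: $\mathbb Z_n$ denotes the ring of integers modulo $n$. For a finite commutative ring $R$ with $1\ne0$, the zero-divisor graph $\Gamma(R)$ has as vertex set the set of non-zero zero-divisors of $R$, and two (not necessarily distinct) vertices $x,y$ are adjacent iff $xy=0$; loops are kept, so the adjacency matrix $A(\Gamma(R))$ has diagonal entry $1$ at $x$ iff $x^2=0$. The eigenvalues of a graph are those of its adjacency matrix. The nullity $\eta(G)$ of a graph $G$ is the multiplicity of the eigenvalue $0$ of its adjacency matrix (it is $0$ for the graph with no vertices). *)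

(* Defs.v *)
From HB Require Import structures.
From mathcomp Require Import all_boot all_order all_algebra.

Set Implicit Arguments.
Unset Strict Implicit.
Unset Printing Implicit Defensive.

Import GRing.Theory Num.Theory.
Local Open Scope ring_scope.

(* MathComp equips only non-dependent finite functions with a ring structure;
   the direct product of a finite family of rings is built here, with all
   operations componentwise. *)
Definition ring_prod (I : finType) (S : I -> comPzRingType) : Type :=
  {dffun forall i : I, S i}.

Section RingProd.
Variables (I : finType) (S : I -> comPzRingType).
Implicit Types f g h : ring_prod S.

HB.instance Definition _ := Choice.copy (ring_prod S) {dffun forall i : I, S i}.

Definition rprod_zero : ring_prod S := [ffun i => 0 : S i].
Definition rprod_one : ring_prod S := [ffun i => 1 : S i].
Definition rprod_opp f : ring_prod S := [ffun i => - f i : S i].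
Definition rprod_add f g : ring_prod S := [ffun i => f i + g i : S i].
Definition rprod_mul f g : ring_prod S := [ffun i => f i * g i : S i].

Fact rprod_addA : associative rprod_add.
Proof. by move=> f g h; apply/ffunP=> i; rewrite !ffunE addrA. Qed.
Fact rprod_addC : commutative rprod_add.
Proof. by move=> f g; apply/ffunP=> i; rewrite !ffunE addrC. Qed.
Fact rprod_add0 : left_id rprod_zero rprod_add.
Proof. by move=> f; apply/ffunP=> i; rewrite !ffunE add0r. Qed.
Fact rprod_addN : left_inverse rprod_zero rprod_opp rprod_add.
Proof. by move=> f; apply/ffunP=> i; rewrite !ffunE addNr. Qed.

HB.instance Definition _ := GRing.isZmodule.Build (ring_prod S)
  rprod_addA rprod_addC rprod_add0 rprod_addN.

Fact rprod_mulA : associative rprod_mul.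
Proof. by move=> f g h; apply/ffunP=> i; rewrite !ffunE mulrA. Qed.
Fact rprod_mulC : commutative rprod_mul.
Proof. by move=> f g; apply/ffunP=> i; rewrite !ffunE mulrC. Qed.
Fact rprod_mul1 : left_id rprod_one rprod_mul.
Proof. by move=> f; apply/ffunP=> i; rewrite !ffunE mul1r. Qed.
Fact rprod_mulDl : left_distributive rprod_mul +%R.
Proof. by move=> f g h; apply/ffunP=> i; rewrite !ffunE mulrDl. Qed.

HB.instance Definition _ := GRing.Zmodule_isComPzRing.Build (ring_prod S)
  rprod_mulA rprod_mulC rprod_mul1 rprod_mulDl.

End RingProd.

Definition ring_isog (R S : pzRingType) : Prop :=
  exists f : {rmorphism R -> S}, bijective f.

Section Graph.
Variables (C : numClosedFieldType) (V : finType) (e : rel V).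

(* The graph with vertex type V and adjacency relation e; a loop at x, i.e.
   e x x, gives a diagonal entry 1. *)
Definition adjacency_matrix : 'M[C]_#|V| :=
  \matrix_(i, j) (e (enum_val i) (enum_val j))%:R.

(* Listed with algebraic multiplicity. *)
Definition graph_eigenvalues : seq C :=
  sval (closed_field_poly_normal (char_poly adjacency_matrix)).

Lemma graph_eigenvaluesE :
  char_poly adjacency_matrix = \prod_(z <- graph_eigenvalues) ('X - z%:P).
Proof.
rewrite /graph_eigenvalues; case: closed_field_poly_normal => s /= {1}->.
by rewrite (monicP (char_poly_monic _)) scale1r.
Qed.

Definition num_nonzero_eigenvalues : nat :=
  count (fun z => z != 0) graph_eigenvalues.

Definition nullity : nat := count_mem 0 graph_eigenvalues.

End Graph.

Section ZeroDivisorGraph.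
Variable R : finComNzRingType.

Definition zero_divisor (x : R) : bool := [exists y : R, (y != 0) && (x * y == 0)].

Definition zdg_vertex : finType := {x : R | (x != 0) && zero_divisor x}.

Definition zdg_adj : rel zdg_vertex := fun x y => val x * val y == 0.

End ZeroDivisorGraph.

(* Main.v *)
(* Let v x be the vector of the p_i-adic valuations of the components of x, each
   truncated at t_i. Then x y = 0 iff v x + v y >= t componentwise, so adjacency
   depends only on the classes of the vectors v x, and there are
   prod (t_i + 1) - 2 classes of vertices (the vectors 0 and t belong to the
   units and to the zero of R). Hence the adjacency matrix is A B, where A is
   the vertex-class incidence matrix and B A is the class adjacency matrix with
   its columns scaled by the class sizes. After the reindexing b |-> t - b of
   the columns, the class adjacency matrix is the zeta matrix of the poset of
   classes, so B A is invertible; as 'X^k char(A B) = 'X^n char(B A), the nonzero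
   eigenvalues of A B, with multiplicities, are as many as the classes. *)

Require Import Defs.
From mathcomp Require Import all_boot all_order all_algebra.
From mathcomp Require Import zify.

Set Implicit Arguments.
Unset Strict Implicit.
Unset Printing Implicit Defensive.

Import GRing.Theory Num.Theory.
Local Open Scope ring_scope.

(** * Characteristic polynomials of the two products of a pair of matrices *)

Lemma char_poly_mulmxC (R : comNzRingType) (m n : nat)
    (A : 'M[R]_(m, n)) (B : 'M[R]_(n, m)) :
  'X^n * char_poly (A *m B) = 'X^m * char_poly (B *m A).
Proof.
rewrite /char_poly /char_poly_mx !map_mxM.
set A' := map_mx _ A; set B' := map_mx _ B.
(* Each product below clears one off-diagonal block of [N], so its determinant is read off the
   diagonal blocks. The extra factors have determinants 1 and ['X^n]. *)
pose N := block_mx ('X%:M : 'M_m) A' B' (1%:M : 'M_n).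
have detN1 : \det (N *m block_mx 1%:M 0 (- B') 1%:M) = \det ('X%:M - A' *m B').
  rewrite mulmx_block !mulmx1 !mulmx0 !mul1mx !add0r mulmxN subrr.
  by rewrite det_ublock det1 mulr1.
have detN2 : \det (N *m block_mx 1%:M (- A') 0 'X%:M)
               = 'X^m * \det ('X%:M - B' *m A').
  rewrite mulmx_block !mulmx1 !mulmx0 !mul1mx !addr0 mulmxN mul_scalar_mx.
  rewrite mul_mx_scalar addNr det_lblock det_scalar mulmxN.
  by rewrite [- _ + _]addrC.
move: detN1 detN2; rewrite !det_mulmx det_lblock det_ublock !det1 det_scalar.
by rewrite !mulr1 mul1r => -> <-; rewrite mulrC.
Qed.

Lemma mup_prod_XsubC (F : fieldType) (x : F) (s : seq F) :
  mup x (\prod_(z <- s) ('X - z%:P)) = count_mem x s.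
Proof.
elim: s => [|z s IHs]; first by rewrite big_nil mupNroot // root1.
rewrite big_cons mupM ?polyXsubC_eq0 ?monic_neq0 ?monic_prod_XsubC //= IHs.
by rewrite -['X - _]expr1 mup_XsubCX; case: (z == x).
Qed.

(** Compare the multiplicities of the root 0 in [char_poly_mulmxC]: when [B *m A] is invertible, 0
    is not a root of its characteristic polynomial. *)
Lemma mup_char_poly_mulmx (F : fieldType) (m n : nat)
    (A : 'M[F]_(m, n)) (B : 'M[F]_(n, m)) :
  B *m A \in unitmx -> (n + mup 0 (char_poly (A *m B)))%N = m.
Proof.
move=> BA_unit; have := congr1 (mup 0) (char_poly_mulmxC A B).
have muX k : mup (0 : F) 'X^k = k.
  by rewrite -['X]subr0 -polyC0 mup_XsubCX eqxx.
rewrite !mupM ?monic_neq0 ?monicXn ?char_poly_monic // !muX => ->.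
rewrite [X in (_ + X)%N]mupNroot ?addn0 //.
rewrite rootE horner_coef0 char_poly_det mulf_eq0 signr_eq0 /=.
by rewrite unitmxE unitfE in BA_unit.
Qed.

(** * Graphs whose adjacency factors through a classification of the vertices *)

Section Quotient.
Variables (C : numClosedFieldType) (V K : finType) (e : rel V).
Variables (c : V -> K) (m : rel K) (s : K -> K) (h : K -> nat).
Hypothesis c_surj : forall k, exists x, c x = k.
Hypothesis eE : forall x y, e x y = m (c x) (c y).
(* The columns of the matrix of m, permuted by s, form a matrix with unit
   diagonal that is triangular for every total order compatible with h. *)
Hypothesis m_diag : forall k, m k (s k).
Hypothesis m_trig : forall k l, m k (s l) -> k != l -> (h l < h k)%N.

Lemma quotient_nullity : (#|K| + nullity C e)%N = #|V|.
Proof.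
pose A : 'M[C]_(#|V|, #|K|) := \matrix_(i, j) (c (enum_val i) == enum_val j)%:R.
pose B : 'M[C]_(#|K|, #|V|) := \matrix_(i, j) (m (enum_val i) (c (enum_val j)))%:R.
have AB : adjacency_matrix C e = A *m B.
  apply/matrixP=> i j; rewrite !mxE eE.
  rewrite (bigD1 (enum_rank (c (enum_val i)))) //= !mxE enum_rankK eqxx mul1r.
  rewrite big1 ?addr0 // => k neq_k; rewrite !mxE.
  by case: eqP => [ck|]; [case/eqP: neq_k; rewrite ck enum_valK | rewrite mul0r].
(* The class sizes scale the columns of [B *m A]; being non-zero, they can be cancelled from the
   equations of its left kernel. *)
pose N k : C := #|[pred x | c x == k]|%:R.
have N_neq0 k : N k != 0.
  rewrite pnatr_eq0; have [x cx] := c_surj k.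
  by rewrite -lt0n; apply/card_gt0P; exists x; rewrite inE cx.
have BA i j : (B *m A) i j = (m (enum_val i) (enum_val j))%:R * N (enum_val j).
  rewrite mxE /N -[X in _ * X%:R]sum1_card natr_sum mulr_sumr.
  rewrite (reindex (@enum_val V predT)) /=; last exact/onW_bij/enum_val_bij.
  rewrite [RHS]big_mkcond /=; apply: eq_bigr => k _; rewrite !mxE inE.
  by case: eqP => [->|]; rewrite ?mulr1 ?mulr0.
rewrite /nullity -mup_prod_XsubC -graph_eigenvaluesE AB mup_char_poly_mulmx //.
rewrite -row_free_unit; apply: inj_row_free => u uBA.
have uM k : \sum_l u 0 (enum_rank l) * (m l k)%:R = 0.
  apply: (mulIf (N_neq0 k)); rewrite mul0r mulr_suml.
  have /rowP/(_ (enum_rank k)) := uBA; rewrite !mxE => uk; rewrite -[RHS]uk.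
  rewrite [RHS](reindex (@enum_rank K)) /=; last exact/onW_bij/enum_rank_bij.
  by apply: eq_bigr => i _; rewrite BA !enum_rankK mulrA.
(* Back substitution from the largest [h] downwards: in column [s k] the coefficient of [k] is 1,
   and any other [l] that occurs has [h k < h l]. *)
have u0 n k : (\max_l h l - h k < n)%N -> u 0 (enum_rank k) = 0.
  elim: n k => // n IHn k lt_n.
  have := uM (s k); rewrite (bigD1 k) //= m_diag mulr1 big1 ?addr0 // => l neq_l.
  case m_l: (m l (s k)); last by rewrite mulr0.
  have lt_kl := m_trig m_l neq_l; rewrite IHn ?mul0r //.
  rewrite -ltnS; apply: leq_trans lt_n; rewrite ltnS; apply: ltn_sub2l => //.
  exact: leq_trans lt_kl (leq_bigmax l).
by apply/rowP=> i; rewrite !mxE -[i]enum_valK (u0 _ _ (ltnSn _)).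
Qed.

Lemma quotient_num_nonzero : num_nonzero_eigenvalues C e = #|K|.
Proof.
apply/eqP; rewrite -(eqn_add2r (nullity C e)) quotient_nullity; apply/eqP.
rewrite addnC /nullity /num_nonzero_eigenvalues count_predC.
apply: succn_inj; rewrite -(size_char_poly (adjacency_matrix C e)).
by rewrite graph_eigenvaluesE size_prod_XsubC.
Qed.

End Quotient.

(** * Truncated valuation modulo a prime power *)

Section Valuation.
Variables (p t : nat).
Hypotheses (p_pr : prime p) (t_gt0 : (0 < t)%N).

(* The case split is needed because logn p 0 = 0. *)
Definition zval (x : 'Z_(p ^ t)) : 'I_t.+1 :=
  inord (if x == 0 then t else logn p x).

Let q_gt1 : (1 < p ^ t)%N.
Proof. by rewrite -(exp1n t) ltn_exp2r ?prime_gt1. Qed.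

Let ltq (x : 'Z_(p ^ t)) : (x < p ^ t)%N.
Proof. by rewrite -[X in (_ < X)%N]Zp_cast. Qed.

Let eq0 (x : 'Z_(p ^ t)) : (x == 0) = (x == 0%N :> nat).
Proof. by []. Qed.

(** [inord] never falls back on its default: for non-zero [x], [p ^ logn p x] divides the
    representative of [x], which is below [p ^ t]. *)
Lemma zvalE (x : 'Z_(p ^ t)) : zval x = (if x == 0 then t else logn p x) :> nat.
Proof.
rewrite inordK //; case: ifPn => // x_neq0; rewrite ltnS.
have x_gt0 : (0 < x)%N by rewrite lt0n -eq0.
rewrite -(@leq_exp2l p) ?prime_gt1 //.
by apply: leq_trans (ltnW (ltq x)); apply: dvdn_leq => //; exact: pfactor_dvdnn.
Qed.

Lemma zval_mul_eq0 (x y : 'Z_(p ^ t)) : (x * y == 0) = (t <= zval x + zval y)%N.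
Proof.
rewrite !zvalE; case: (eqVneq x 0) => [->|x_neq0]; first by rewrite mul0r eqxx leq_addr.
case: (eqVneq y 0) => [->|y_neq0]; first by rewrite mulr0 eqxx leq_addl.
rewrite eq0 /= -/(dvdn _ _) [X in (X %| _)%N]Zp_cast // -lognM ?lt0n -?eq0 //.
by rewrite -pfactor_dvdn // muln_gt0 !lt0n -!eq0 x_neq0.
Qed.

Lemma zval_surj (a : 'I_t.+1) : exists x, zval x = a.
Proof.
(* For [a = t] this witness is 0, whose truncated valuation is [t]. *)
exists (p ^ a)%:R; apply/val_inj; rewrite /= zvalE eq0 val_Zp_nat //.
have := ltn_ord a; rewrite ltnS leq_eqVlt => /orP[/eqP ->|lt_at].
  by rewrite modnn.
rewrite modn_small ?ltn_exp2l ?prime_gt1 // pfactorK //.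
by rewrite -leqn0 leqNgt expn_gt0 prime_gt0.
Qed.

(** Valuation 0 means a representative prime to [p], that is, a unit; 0 is excluded because [t] is
    positive. *)
Lemma card_zval0 : #|[pred x | zval x == ord0]| = totient (p ^ t).
Proof.
rewrite -card_units_Zp ?expn_gt0 ?prime_gt0 // cardsT card_sub.
apply: eq_card => x; rewrite !inE -[in RHS](natr_Zp x) unitZpE //.
rewrite -val_eqE /= zvalE coprime_pexpl // prime_coprime //.
case: (eqVneq x 0) => [->|x_neq0].
  by rewrite dvdn0; apply/negbTE; rewrite -lt0n.
by rewrite -[X in (X %| _)%N]expn1 pfactor_dvdn ?lt0n -?eq0 ?negbK.
Qed.

End Valuation.

(** * Zero-divisor graph of a ring with a vector of truncated valuations *)

Section ZeroDivisorClasses.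
Variables (C : numClosedFieldType) (R : finComNzRingType) (r : nat).
Variable t : 'I_r -> nat.
Hypotheses (r_gt0 : (0 < r)%N) (t_gt0 : forall i, (0 < t i)%N).

Let T := {dffun forall i : 'I_r, 'I_(t i).+1}.
Variable v : R -> T.
Hypothesis v_surj : forall a, exists x, v x = a.
Hypothesis v_mul : forall x y, (x * y == 0) = [forall i, t i <= v x i + v y i]%N.

Let bot : T := [ffun i => ord0].
Let top : T := [ffun i => ord_max].
(** This is t - a, the least vector b with a + b >= t componentwise. *)
Let compl (a : T) : T := [ffun i => rev_ord (a i)].

Let top_neq_bot : top != bot.
Proof.
apply/eqP=> /ffunP/(_ (Ordinal r_gt0)); rewrite !ffunE => /(congr1 val) /= t0.
by have := t_gt0 (Ordinal r_gt0); rewrite t0.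
Qed.

Let complK : involutive compl.
Proof. by move=> a; apply/ffunP=> i; rewrite !ffunE rev_ordK. Qed.

Let compl_bot : compl bot = top.
Proof. by apply/ffunP=> i; rewrite !ffunE; apply/val_inj; rewrite /= subn1. Qed.

Let compl_eq_top a : (compl a == top) = (a == bot).
Proof. by rewrite -compl_bot (can_eq complK). Qed.

Let compl_eq_bot a : (compl a == bot) = (a == top).
Proof. by rewrite -compl_bot -(can_eq complK) complK. Qed.

(** Apply [v_mul] to [x * 1] in one direction, and to [0 * y] with [v y = bot] in the other. *)
Lemma valuation_eq_top x : (v x == top) = (x == 0).
Proof.
have [y vy] := v_surj bot; apply/eqP/eqP => [vx|->].
  apply/eqP; rewrite -[x]mulr1 v_mul vx; apply/forallP=> i.
  by rewrite ffunE leq_addr.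
have /forallP v0 : [forall i, t i <= v (0 : R)%R i + v y i]%N by rewrite -v_mul mul0r.
apply/ffunP=> i; rewrite !ffunE; apply/val_inj/eqP; rewrite /= eqn_leq.
by rewrite -ltnS ltn_ord /=; have := v0 i; rewrite vy ffunE addn0.
Qed.

(** An element of valuation [compl (v x)] annihilates [x], and it is non-zero exactly when [v x] is
    not [bot]. *)
Lemma zero_divisor_valuation x : zero_divisor x = (v x != bot).
Proof.
apply/existsP/idP => [[y /andP[y_neq0 /eqP xy]]|vx].
  apply: contra y_neq0 => /eqP vx; rewrite -valuation_eq_top.
  have /forallP v0 : [forall i, t i <= v x i + v y i]%N by rewrite -v_mul xy.
  apply/eqP/ffunP=> i; rewrite !ffunE; apply/val_inj/eqP; rewrite /= eqn_leq.
  by rewrite -ltnS ltn_ord /=; have := v0 i; rewrite vx ffunE add0n.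
have [y vy] := v_surj (compl (v x)); exists y; rewrite -valuation_eq_top vy.
rewrite compl_eq_top vx v_mul; apply/forallP=> i.
by rewrite vy ffunE /= subSS subnKC // -ltnS.
Qed.

Let K : finType := {a : T | (a != top) && (a != bot)}.

Let cls_subproof (x : zdg_vertex R) : (v (val x) != top) && (v (val x) != bot).
Proof. by have := valP x; rewrite valuation_eq_top zero_divisor_valuation. Qed.

Let cls (x : zdg_vertex R) : K := Sub (v (val x)) (cls_subproof x).

Let Kcompl_subproof (a : K) : (compl (val a) != top) && (compl (val a) != bot).
Proof. by rewrite compl_eq_top compl_eq_bot andbC; exact: valP a. Qed.

Let Kcompl (a : K) : K := Sub (compl (val a)) (Kcompl_subproof a).

Let mulK : rel K := fun a b => [forall i, t i <= val a i + val b i]%N.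

Let cls_surj k : exists x, cls x = k.
Proof.
have [x vx] := v_surj (val k).
have xP : (x != 0) && zero_divisor x.
  by rewrite -valuation_eq_top zero_divisor_valuation vx (valP k).
by exists (Sub x xP); apply/val_inj.
Qed.

Let adjE x y : zdg_adj x y = mulK (cls x) (cls y).
Proof. by rewrite /zdg_adj v_mul. Qed.

Let mulK_diag k : mulK k (Kcompl k).
Proof. by apply/forallP=> i; rewrite ffunE /= subSS subnKC // -ltnS. Qed.

(* mulK k (Kcompl l) means that l <= k componentwise. *)
Let mulK_trig k l : mulK k (Kcompl l) -> k != l ->
  (\sum_i val l i < \sum_i val k i)%N.
Proof.
move=> /forallP kl neq_kl.
have le_lk i : (val l i <= val k i)%N.
  by have := kl i; have := ltn_ord (val l i); rewrite ffunE /=; lia.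
rewrite ltn_neqAle leq_sum // andbT; apply: contra neq_kl => /eqP eq_sum.
(* Componentwise comparable vectors with equal sums are equal. *)
have /leqif_sum := fun i (_ : true) => leqif_eq (le_lk i).
case=> _; rewrite eq_sum eqxx => /esym/forallP eq_lk.
by apply/eqP/val_inj/ffunP=> i; apply/val_inj/esym/eqP/eq_lk.
Qed.

Lemma zdg_num_nonzero :
  (num_nonzero_eigenvalues C (@zdg_adj R) + 2 = \prod_i (t i).+1)%N.
Proof.
rewrite (quotient_num_nonzero C cls_surj adjE mulK_diag mulK_trig).
rewrite card_sub.
have -> : (\prod_i (t i).+1 = #|T|)%N.
  rewrite card_dep_ffun foldrE big_image /=.
  by apply: eq_bigr => i _; rewrite card_ord.
rewrite -(cardC (pred2 top bot)) addnC card2 top_neq_bot; congr addn.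
by apply: eq_card => a; rewrite !inE negb_or.
Qed.

(** The ring splits into the vertices, the elements of valuation [bot] and 0. The additive form
    avoids truncated subtraction. *)
Lemma zdg_nullity :
  (#|[pred x : R | v x == bot]| + nullity C (@zdg_adj R) + \prod_i (t i).+1
    = #|R| + 1)%N.
Proof.
have cardR : (#|zdg_vertex R| + #|[pred x : R | v x == bot]|.+1 = #|R|)%N.
  have v0 : v 0 = top by apply/eqP; rewrite valuation_eq_top.
  rewrite card_sub -(cardC [pred x : R | (x != 0) && zero_divisor x]).
  congr addn; rewrite -add1n.
  (* This 1 counts the zero of [R], in the shape used by [cardU1]. *)
  have -> : 1%N = (0 \notin [pred x : R | v x == bot]).
    by rewrite inE v0 top_neq_bot.
  rewrite -cardU1; apply: eq_card => x.
  by rewrite !inE zero_divisor_valuation negb_and !negbK.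
rewrite -zdg_num_nonzero -cardR.
rewrite -(quotient_nullity C cls_surj adjE mulK_diag mulK_trig).
rewrite (quotient_num_nonzero C cls_surj adjE mulK_diag mulK_trig).
lia.
Qed.

End ZeroDivisorClasses.

(** * Valuations and cardinals for a product of rings of integers modulo prime powers *)

Theorem theorem4p2 (C : numClosedFieldType) (R : finComNzRingType)
    (r : nat) (p t : 'I_r -> nat)
    (hr : (0 < r)%N)
    (hp : forall i : 'I_r, prime (p i))
    (ht : forall i : 'I_r, (0 < t i)%N)
    (hR : ring_isog R (ring_prod (fun i : 'I_r => 'Z_(p i ^ t i)))) :
  (num_nonzero_eigenvalues C (@zdg_adj R))%:Z
    = (\prod_(i < r) ((t i)%:Z + 1)) - 2
  /\
  (nullity C (@zdg_adj R))%:Z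
    = (\prod_(i < r) (p i)%:Z ^+ (t i - 1))
        * ((\prod_(i < r) (p i)%:Z) - (\prod_(i < r) ((p i)%:Z - 1)))
      - (\prod_(i < r) ((t i)%:Z + 1)) + 1.
Proof.
have [f f_bij] := hR.
pose v (x : R) : {dffun forall i : 'I_r, 'I_(t i).+1} :=
  [ffun i => zval (f x i)].
have v_surj a : exists x, v x = a.
  have [g _ fK] := f_bij.
  have a_surj i : exists y : 'Z_(p i ^ t i), zval y == a i.
    by have [y <-] := zval_surj (hp i) (ht i) (a i); exists y.
  exists (g [ffun i => xchoose (a_surj i)]).
  by apply/ffunP=> i; rewrite ffunE fK ffunE; apply/eqP/(xchooseP (a_surj i)).
have v_mul x y : (x * y == 0) = [forall i, t i <= v x i + v y i]%N.
  rewrite -(inj_eq (bij_inj f_bij)) rmorphM rmorph0.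
  apply/eqP/forallP => [/ffunP fxy i|vxy].
    by rewrite !ffunE -zval_mul_eq0 //; have := fxy i; rewrite !ffunE => ->.
  apply/ffunP=> i; rewrite !ffunE; apply/eqP.
  by have := vxy i; rewrite !ffunE -zval_mul_eq0.
have cardR : #|R| = (\prod_(i < r) p i ^ t i)%N.
  rewrite (@bij_eq_card R {dffun forall i : 'I_r, 'Z_(p i ^ t i)} f f_bij).
  rewrite card_dep_ffun foldrE big_image /=.
  apply: eq_bigr => i _; rewrite card_ord Zp_cast //.
  by rewrite -(exp1n (t i)) ltn_exp2r ?prime_gt1.
have card0 : #|[pred x | v x == [ffun i => ord0]]|
    = (\prod_(i < r) ((p i).-1 * p i ^ (t i).-1))%N.
  pose F (i : 'I_r) : pred 'Z_(p i ^ t i) := [pred y | zval y == ord0].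
  (* Through the bijection [f], valuation 0 becomes a product of local conditions, so the count is a
     product of totients. *)
  transitivity #|(f : R -> {dffun forall i : 'I_r, 'Z_(p i ^ t i)}) @^-1: family F|.
    apply: eq_card => x; rewrite !inE; apply/eqP/familyP=> [/ffunP vx i|vx].
      by have := vx i; rewrite !ffunE inE => ->.
    by apply/ffunP=> i; rewrite !ffunE; apply/eqP/(vx i).
  rewrite on_card_preimset; last by apply: onW_bij.
  rewrite card_family foldrE big_image /=.
  by apply: eq_bigr => i _; rewrite card_zval0 // totient_pfactor.
have nz := zdg_num_nonzero C hr ht v_surj v_mul.
have nu := zdg_nullity C hr ht v_surj v_mul.
have PoszX a b : (a ^ b)%N%:Z = a%:Z ^+ b by rewrite -!natz natrX.
have Posz_prod F : (\prod_(i < r) F i)%N%:Z = \prod_(i < r) (F i)%:Z.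
  exact: (big_morph Posz PoszM).
have prodT : \prod_(i < r) ((t i)%:Z + 1) = (\prod_(i < r) (t i).+1)%N.
  by rewrite Posz_prod; apply: eq_bigr => i _; rewrite -addn1 PoszD.
(* Once distributed, the first term of the nullity formula is the order of [R] minus the number of
   its elements of valuation 0. *)
have prodR : (\prod_(i < r) (p i)%:Z ^+ (t i - 1)) * \prod_(i < r) (p i)%:Z
    = #|R|.
  rewrite -big_split cardR Posz_prod /=; apply: eq_bigr => i _.
  by rewrite PoszX subn1 -exprSr prednK.
have prod0 : (\prod_(i < r) (p i)%:Z ^+ (t i - 1)) * \prod_(i < r) ((p i)%:Z - 1)
    = #|[pred x | v x == [ffun i => ord0]]|.
  rewrite -big_split card0 Posz_prod /=; apply: eq_bigr => i _.
  by rewrite PoszM PoszX subn1 mulrC predn_int ?prime_gt0.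
rewrite mulrBr prodR prod0 prodT -nz; split; first lia.
by move: nu; rewrite -nz; move: (nullity _ _) #|_| #|_|; lia.
Qed.
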